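(* Let $n\ge 0$ be an integer and let $k$ be a positive integer. If $k$ is even, then $$\mathcal{E}_{n,q}-\mathcal{E}_{n,q}(k)=[2]_q\sum_{l=0}^{k-1}(-1)^l[l]_q^n .$$ If $k$ is odd, then $$\mathcal{E}_{n,q}+\mathcal{E}_{n,q}(k)=[2]_q\sum_{l=0}^{k-1}(-1)^l[l]_q^n .$$
   Context: Let $p$ be a fixed odd prime, $\mathbb{Z}_p$ the ring of $p$-adic integers, $\mathbb{C}_p$ the completion of an algebraic closure of $\mathbb{Q}_p$, with absolute value normalized by $|p|_p=1/p$. Let $q\in\mathbb{C}_p$ with $|q-1|_p<p^{-1/(p-1)}$ and $q\neq 1$, and put $q^x=\exp(x\log q)$ for $x\in\mathbb{Z}_p$. Write $[x]_q=\frac{1-q^x}{1-q}$ and, for $N\in\mathbb{N}$, $[N]_{-q}=\frac{1-(-q)^N}{1+q}$; in particular $[2]_q=1+q$. The convention $[0]_q^0=1$ is used. The fermionic $p$-adic $q$-integral of a function $f$ on $\mathbb{Z}_p$ is $$I_{-q}(f)=\int_{\mathbb{Z}_p}f(x)\,d\mu_{-q}(x)=\lim_{N\to\infty}\frac{1}{[p^N]_{-q}}\sum_{x=0}^{p^N-1}f(x)(-q)^x .$$ The modified $q$-Euler numbers and polynomials are, for $n\ge 0$, $$\mathcal{E}_{n,q}=\int_{\mathbb{Z}_p}q^{-x}[x]_q^n\,d\mu_{-q}(x)=[2]_q\Big(\frac{1}{1-q}\Big)^n\sum_{l=0}^n\binom{n}{l}(-1)^l\frac{1}{1+q^l},$$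 $$\mathcal{E}_{n,q}(x)=\int_{\mathbb{Z}_p}q^{-t}[x+t]_q^n\,d\mu_{-q}(t)=[2]_q\Big(\frac{1}{1-q}\Big)^n\sum_{l=0}^n\binom{n}{l}(-1)^l\frac{q^{xl}}{1+q^l}.$$ *)

(* Defs.v *)
From mathcomp Require Import all_boot all_order all_algebra.
From mathcomp Require Import all_classical all_reals all_analysis.

Set Implicit Arguments.
Unset Strict Implicit.
Unset Printing Implicit Defensive.

Import Order.TTheory GRing.Theory Num.Theory.
Import numFieldNormedType.Exports.

Local Open Scope classical_set_scope.
Local Open Scope ring_scope.

(* Fields with an R-valued absolute value have no structure in the library's
   hierarchy (a norm on a numFieldType takes its values in that field), so the
   absolute value and the metric notions it induces are explicit here. *)
Section AbsoluteValue.
Context (R : realType) (K : fieldType) (abs : K -> R).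
Implicit Types (u : nat -> K) (x y l : K) (A : set K).

Record nonarch_absolute_value : Prop := NonarchAbsoluteValue {
  abs_ge0 : forall x, 0 <= abs x ;
  abs_eq0 : forall x, abs x = 0 <-> x = 0 ;
  abs_mul : forall x y, abs (x * y) = abs x * abs y ;
  abs_ultra : forall x y, abs (x + y) <= Num.max (abs x) (abs y)
}.

Definition abs_cvg u l : Prop := abs (u n - l) @[n --> \oo] --> (0 : R).

(* 0 when u diverges. *)
Definition abs_lim u : K := xget 0 [set l | abs_cvg u l].

Definition abs_cauchy u : Prop :=
  forall e : R, 0 < e -> exists N : nat, forall m n : nat,
    (N <= m)%N -> (N <= n)%N -> abs (u m - u n) < e.

Definition abs_complete : Prop :=
  forall u, abs_cauchy u -> exists l, abs_cvg u l.

Definition abs_closure A : set K :=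
  [set x | forall e : R, 0 < e -> exists2 y, A y & abs (x - y) < e].

Definition abs_sum u : K := abs_lim (fun M => \sum_(0 <= m < M) u m).

End AbsoluteValue.

Section PadicComplex.
Context (R : realType) (p : nat) (K : fieldType) (abs : K -> R).

(* When K is complete and abs p = 1/p, the closure of the rationals in K is
   the completion of the rationals for the p-adic absolute value. *)
Definition Qp : set K := abs_closure abs (range (ratr : rat -> K)).

Definition Qpbar : set K :=
  [set x | exists P : {poly K}, [/\ P != 0, forall i, Qp P`_i & root P x]].

(* (K, abs) is the completion of an algebraic closure of Q_p; this determines
   it up to isometric isomorphism. *)
Record is_padic_complex : Prop := IsPadicComplex {
  padic_abs : nonarch_absolute_value abs ;
  padic_abs_p : abs p%:R = p%:R^-1 ;
  padic_complete : abs_complete abs ;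
  padic_closed : forall P : {poly K}, (1 < size P)%N ->
    (forall i, Qpbar P`_i) -> exists2 x, Qpbar x & root P x ;
  padic_dense : abs_closure abs Qpbar = setT
}.

End PadicComplex.

Section QEuler.
Context (R : realType) (p : nat) (K : fieldType) (abs : K -> R).
Implicit Types (q x y : K) (n N : nat) (f : K -> K).

Definition pexp y : K := abs_sum abs (fun m => y ^+ m / m`!%:R).

(* The term of index 0 vanishes, since 0^-1 = 0. *)
Definition plog q : K :=
  abs_sum abs (fun m => (-1) ^+ m.+1 * (q - 1) ^+ m / m%:R).

Definition qpow q x : K := pexp (x * plog q).

Definition qnum q x : K := (1 - qpow q x) / (1 - q).

Definition qnum_neg q N : K := (1 - (- q) ^+ N) / (1 + q).

(* The p-adic integers are seen inside K, and a function on them as a function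
   on K; only its values at the natural numbers matter. *)
Definition fermionic_int q f : K :=
  abs_lim abs (fun N => (qnum_neg q (p ^ N))^-1 *
                        \sum_(0 <= x < p ^ N) f x%:R * (- q) ^+ x).

Definition qEuler q n : K :=
  fermionic_int q (fun x => qpow q (- x) * qnum q x ^+ n).

Definition qEuler_poly q n x : K :=
  fermionic_int q (fun t => qpow q (- t) * qnum q (x + t) ^+ n).

End QEuler.

(* Main.v *)
Require Import Defs.
From mathcomp Require Import all_boot all_order all_algebra.
From mathcomp Require Import all_classical all_reals all_analysis.
From mathcomp Require Import ring lra.

Set Implicit Arguments.
Unset Strict Implicit.
Unset Printing Implicit Defensive.

Import Order.TTheory GRing.Theory Num.Theory.
Import numFieldNormedType.Exports.

Local Open Scope classical_set_scope.
Local Open Scope ring_scope.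

(** The statement compares two fermionic integrals, and both have a closed
    form. For odd [M], the alternating geometric sum of [q ^ (l x)] over
    [x < M] is [(1 + q ^ (l M)) / (1 + q ^ l)]. Expanding [[k + x]_q ^ n] by
    the binomial formula therefore writes the sum over [x < p ^ N] that
    approximates [qEuler_poly p abs q n k] as a fixed finite combination of the
    ratios [(1 + q ^ (l p ^ N)) / (1 + q ^ (p ^ N))], and these tend to 1
    because [q ^ (p ^ N)] tends to 1 (lemma [qEuler_polyE]). In the closed form
    [k] occurs only through [q ^ (k l)], so that
    [qEuler n - (-1) ^ k * qEuler_poly n k] is a combination of the quotients
    [(1 - (-1) ^ k q ^ (k l)) / (1 + q ^ l)]. These are again alternating
    geometric sums, now of length [k], and reading the binomial formula
    backwards gives the right-hand side (lemma [qEuler_sub_signed_poly]).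

    The analytic input is that [qpow abs q], defined as [exp (x log q)] with
    convergent series, agrees with the algebraic powers of [q] at the integers:
    [exp] turns sums into products, and [exp (log q) = q] when
    [|q - 1| < p ^ (-1 / (p - 1))]. The latter is proved without composing the
    two power series. With [M = p ^ N], which tends to 0, both series are
    controlled by the powers of exponent [M]:
    [log u] is within [|M|] of [(u ^ M - 1) / M]
    ([plog_difference_quotient]), since ['C(M - 1, j)] is close to
    [(-1) ^ j]; and [exp y ^ M = exp (M y)] is within [|M| ^ 2] of [1 + M y]
    ([pexp_nat_taylor]). The two estimates give [log (exp y) = y]; the first
    one gives the injectivity of [log]; hence [exp (log u) = u]
    ([pexp_plog]). *)

(** * Finite sums *)

Lemma cauchy_product_partial (S : pzSemiRingType) (a b : nat -> S) M :
  \sum_(0 <= m < M) \sum_(0 <= i < m.+1) a (m - i)%N * b i =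
  \sum_(0 <= i < M) (\sum_(0 <= j < M - i) a j) * b i.
Proof.
elim: M => [|M IH]; first by rewrite !big_nil.
rewrite big_nat_recr//= IH !(big_nat_recr M)//= addrA -big_split/= subSnn.
rewrite subnn big_nat1; congr (_ + _); apply: eq_big_nat => i /andP[_ iM].
by rewrite subSn 1?ltnW// big_nat_recr//= mulrDl.
Qed.

Lemma expr_1B (S : comPzRingType) (x : S) n :
  (1 - x) ^+ n = \sum_(0 <= l < n.+1) (-1) ^+ l * 'C(n, l)%:R * x ^+ l.
Proof.
rewrite exprBn big_mkord; apply: eq_bigr => i _.
by rewrite expr1n mulr1 -mulr_natr mulrAC.
Qed.

Lemma sum_alternating_geometric (F : fieldType) (z : F) m : 1 + z != 0 ->
  \sum_(0 <= x < m) (-1) ^+ x * z ^+ x = (1 - (-1) ^+ m * z ^+ m) / (1 + z).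
Proof.
move=> z0; apply: (mulIf z0); rewrite divfK//.
rewrite -[RHS]opprB -exprMn mulN1r subrX1 big_mkord -mulNr opprB opprK mulrC.
by congr (_ * _); apply: eq_bigr => i _; rewrite -exprMn mulN1r.
Qed.

(** * Nonarchimedean absolute values *)

Section Nonarchimedean.
Context (R : realType) (K : fieldType) (abs : K -> R).
Context (habs : nonarch_absolute_value abs).
Implicit Types (x y c l : K) (u v a : nat -> K) (B : R).

Let ge0 x : 0 <= abs x := abs_ge0 habs x.
Hint Resolve ge0 : core.

Lemma absM x y : abs (x * y) = abs x * abs y.
Proof. exact: abs_mul habs x y. Qed.

Lemma abs0 : abs 0 = 0.
Proof. exact/(abs_eq0 habs). Qed.

Lemma abs_gt0 x : x != 0 -> 0 < abs x.
Proof.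
move=> /eqP x0; rewrite lt_neqAle ge0 andbT eq_sym.
by apply/eqP => /(abs_eq0 habs).
Qed.

Lemma abs1 : abs 1 = 1.
Proof.
have /mulfI : abs 1 != 0 by rewrite gt_eqF// abs_gt0// oner_eq0.
by apply; rewrite -absM !mulr1.
Qed.

Lemma absN x : abs (- x) = abs x.
Proof.
have N1 : abs (-1) = 1.
  have : abs (-1) ^+ 2 = 1 by rewrite expr2 -absM mulrNN mulr1 abs1.
  by move/eqP; rewrite sqrf_eq1 => /orP[/eqP//|/eqP h]; have := ge0 (-1); lra.
by rewrite -mulN1r absM N1 mul1r.
Qed.

Lemma abs_subC x y : abs (x - y) = abs (y - x).
Proof. by rewrite -absN opprB. Qed.

Lemma absX x n : abs (x ^+ n) = abs x ^+ n.
Proof. by elim: n => [|n IH]; rewrite ?abs1// !exprS absM IH. Qed.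

Lemma abs_sign n : abs ((-1) ^+ n) = 1.
Proof. by rewrite absX absN abs1 expr1n. Qed.

Lemma absV x : abs x^-1 = (abs x)^-1.
Proof.
have [->|x0] := eqVneq x 0; first by rewrite invr0 abs0 invr0.
have /mulfI : abs x != 0 by rewrite gt_eqF// abs_gt0.
by apply; rewrite -absM !divff ?abs1// gt_eqF// abs_gt0.
Qed.

Lemma abs_add_le x y B : abs x <= B -> abs y <= B -> abs (x + y) <= B.
Proof.
by move=> hx hy; apply: le_trans (abs_ultra habs x y) _; rewrite ge_max hx.
Qed.

Lemma abs_sub_le x y B : abs x <= B -> abs y <= B -> abs (x - y) <= B.
Proof. by move=> hx hy; apply: abs_add_le; rewrite ?absN. Qed.

Lemma abs_sub_lt x y B : abs x < B -> abs y < B -> abs (x - y) < B.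
Proof.
move=> hx hy; apply: le_lt_trans (abs_ultra habs x (- y)) _.
by rewrite gt_max hx absN.
Qed.

Lemma abs_sum_le (I : Type) (r : seq I) (P : pred I) (F : I -> K) B :
  0 <= B -> (forall i, P i -> abs (F i) <= B) ->
  abs (\sum_(i <- r | P i) F i) <= B.
Proof.
move=> B0 hF; apply: (big_ind (fun x => abs x <= B)) => //.
  by rewrite abs0.
by move=> x y; apply: abs_add_le.
Qed.

Lemma abs_sum_nat_le m n (F : nat -> K) B :
  0 <= B -> (forall i, (m <= i < n)%N -> abs (F i) <= B) ->
  abs (\sum_(m <= i < n) F i) <= B.
Proof.
by move=> B0 hF; rewrite big_seq; apply: abs_sum_le => // i;
  rewrite mem_index_iota; apply: hF.
Qed.

Lemma abs_nat_le1 n : abs n%:R <= 1.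
Proof.
by elim: n => [|n IH]; rewrite ?abs0// -natr1; apply: abs_add_le; rewrite ?abs1.
Qed.

(** The open ball of radius 1 around 1 consists of units. *)
Lemma abs_eq1 x : abs (x - 1) < 1 -> abs x = 1.
Proof.
move=> h; apply/eqP; rewrite eq_le; apply/andP; split.
  by rewrite -(subrK 1 x); apply: abs_add_le; rewrite ?abs1// ltW.
rewrite leNgt; apply/negP => hx.
have := abs_sub_lt hx h; rewrite opprB addrC subrK abs1; lra.
Qed.

Lemma abs_expr_sub1 x n : abs (x - 1) < 1 -> abs (x ^+ n - 1) <= abs (x - 1).
Proof.
move=> h; rewrite subrX1 absM ler_piMr//.
by apply: abs_sum_le => // i _; rewrite absX (abs_eq1 h) expr1n.
Qed.

(** * Limits and series *)

Lemma abs_cvgP u l : abs_cvg abs u l <->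
  (forall e : R, 0 < e -> exists N, forall n, (N <= n)%N -> abs (u n - l) < e).
Proof.
split.
  move/cvgrPdist_lt => h e e0; have [N _ hN] := h e e0.
  exists N => n /hN /=; rewrite sub0r normrN ger0_norm//.
move=> h; apply/cvgrPdist_lt => e e0; have [N hN] := h e e0.
by exists N => // n /= /hN; rewrite sub0r normrN ger0_norm.
Qed.

Lemma abs_cvg_squeeze u l (e : nat -> R) :
  e n @[n --> \oo] --> (0 : R) -> (forall n, abs (u n - l) <= e n) ->
  abs_cvg abs u l.
Proof.
move=> he h; apply: (squeeze_cvgr _ (cvg_cst (0 : R)) he).
by near=> n; rewrite ge0 h.
Unshelve. all: by end_near. Qed.

(** Closed balls are closed, which turns estimates on partial sums into
    estimates on sums. *)
Lemma abs_cvg_le u l c B : abs_cvg abs u l ->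
  (exists N, forall n, (N <= n)%N -> abs (u n - c) <= B) -> abs (l - c) <= B.
Proof.
move=> /abs_cvgP hu [N hN]; rewrite leNgt; apply/negP => hB.
have lc0 : 0 < abs (l - c).
  by apply: le_lt_trans hB; apply: le_trans (hN N (leqnn N)).
have [N' hN'] := hu _ lc0.
have h1 := hN' _ (leq_maxr N N'); have h2 := hN _ (leq_maxl N N').
set n := maxn N N' in h1 h2; rewrite abs_subC in h1.
suff : abs (l - c) < abs (l - c) by rewrite ltxx.
rewrite -{1}(subrK (u n) l) -addrA.
by apply: le_lt_trans (abs_ultra habs _ _) _; rewrite gt_max h1 (le_lt_trans h2).
Qed.

Lemma abs_cvg_unique u l l' : abs_cvg abs u l -> abs_cvg abs u l' -> l = l'.
Proof.
move=> hl hl'; apply/eqP; rewrite -subr_eq0; apply/eqP/(abs_eq0 habs)/eqP.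
rewrite eq_le ge0 andbT; apply/ler_addgt0Pr => e e0; rewrite add0r.
apply: (abs_cvg_le hl); have [N hN] := (abs_cvgP _ _).1 hl' e e0.
by exists N => n /hN /ltW.
Qed.

Lemma abs_limE u l : abs_cvg abs u l -> abs_lim abs u = l.
Proof.
move=> hl; apply: (abs_cvg_unique _ hl).
by have := @xgetPex _ 0 [set x | abs_cvg abs u x]; apply; exists l.
Qed.

Lemma abs_cvg_cst c : abs_cvg abs (fun=> c) c.
Proof.
apply: (@abs_cvg_squeeze _ _ (fun=> 0)); first exact: cvg_cst.
by move=> n; rewrite subrr abs0.
Qed.

Lemma abs_cvgZ c u l : abs_cvg abs u l ->
  abs_cvg abs (fun n => c * u n) (c * l).
Proof.
move=> hu; apply: (@abs_cvg_squeeze _ _ (fun n => abs c * abs (u n - l))).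
  by rewrite -[X in _ --> X](mulr0 (abs c)); apply: cvgMr.
by move=> n; rewrite -mulrBr absM.
Qed.

Lemma abs_cvgD u v l l' : abs_cvg abs u l -> abs_cvg abs v l' ->
  abs_cvg abs (fun n => u n + v n) (l + l').
Proof.
move=> hu hv; apply: (@abs_cvg_squeeze _ _
    (fun n => abs (u n - l) + abs (v n - l'))).
  by rewrite -[X in _ --> X](addr0 (0 : R)); apply: cvgD.
move=> n; rewrite opprD addrACA.
by apply: abs_add_le; rewrite ?lerDl ?lerDr.
Qed.

Lemma abs_cvgM u v l l' : abs_cvg abs u l -> abs_cvg abs v l' ->
  abs_cvg abs (fun n => u n * v n) (l * l').
Proof.
move=> hu hv.
have huv : abs_cvg abs (fun n => (u n - l) * (v n - l')) 0.
  apply: (@abs_cvg_squeeze _ _ (fun n => abs (u n - l) * abs (v n - l'))).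
    by rewrite -[X in _ --> X](mulr0 (0 : R)); apply: cvgM.
  by move=> n; rewrite subr0 absM.
have := abs_cvgD huv (abs_cvgD (abs_cvgD (abs_cvgZ l' hu) (abs_cvgZ l hv))
  (abs_cvg_cst (- (l * l')))).
have -> : 0 + (l' * l + l * l' - l * l') = l * l' by ring.
by congr abs_cvg; apply: boolp.funext => n; ring.
Qed.

Lemma abs_cvg_sum n (u : nat -> nat -> K) (l : nat -> K) :
  (forall i, abs_cvg abs (u i) (l i)) ->
  abs_cvg abs (fun N => \sum_(0 <= i < n) u i N) (\sum_(0 <= i < n) l i).
Proof.
move=> h; elim: n => [|n IH].
  apply/abs_cvgP => e e0; exists 0%N => N _.
  by rewrite !big_nil subrr abs0.
rewrite big_nat_recr//=; under [fun N => _]boolp.funext do rewrite big_nat_recr//=.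
exact: abs_cvgD.
Qed.

(** In a complete nonarchimedean field a series converges as soon as its
    general term tends to 0. *)
Lemma abs_cvg_series a : abs_complete abs -> abs_cvg abs a 0 ->
  abs_cvg abs (fun M => \sum_(0 <= m < M) a m) (abs_sum abs a).
Proof.
move=> complete /abs_cvgP a0.
have [l hl] : exists l, abs_cvg abs (fun M => \sum_(0 <= m < M) a m) l.
  apply: complete => e e0; have [N hN] := a0 _ e0; exists N => m n.
  wlog mn : m n / (m <= n)%N.
    move=> W hm hn; have [/W|/ltnW/W] := leqP m n; first exact.
    by rewrite abs_subC; apply.
  move=> hm hn; rewrite abs_subC (big_cat_nat (leq0n m) mn)//=.
  rewrite addrAC subrr add0r.
  rewrite big_seq; apply: (big_ind (fun x => abs x < e)).
  - by rewrite abs0.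
  - move=> x y hx hy; rewrite -(opprK y).
    by apply: abs_sub_lt; rewrite ?absN.
  - move=> i; rewrite mem_index_iota => /andP[mi _].
    by rewrite -(subr0 (a i)); apply: hN; apply: leq_trans mi.
by rewrite /abs_sum (abs_limE hl).
Qed.

Lemma abs_sum_sub_le a c B : abs_complete abs -> abs_cvg abs a 0 ->
  (exists N, forall M, (N <= M)%N -> abs (\sum_(0 <= m < M) a m - c) <= B) ->
  abs (abs_sum abs a - c) <= B.
Proof. by move=> complete a0; apply: abs_cvg_le; apply: abs_cvg_series. Qed.

End Nonarchimedean.

(** * Factorials and the terms of the exponential series *)

(** Legendre's bound; [m - 1] is attained when [m] is a power of [p]. *)
Lemma logn_fact_lt p m : prime p -> (0 < m)%N -> (p.-1 * logn p m`! < m)%N.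
Proof.
move=> hp; have p0 := prime_gt0 hp; rewrite logn_fact// big_add1 /=.
(* The number of summands is decoupled from [m], so that the induction can
   remove a factor [p] from [m]. *)
move: {2}m => k; elim: k m => [|k IH] m m0.
  by rewrite big_nil muln0.
rewrite big_nat_recl//= expn1.
under eq_bigr do rewrite expnS divnMA.
have [d0|d0] := posnP (m %/ p).
  rewrite d0; under eq_bigr do rewrite div0n.
  by rewrite big1_eq addn0 muln0.
have := IH _ d0; rewrite mulnDr -(ltn_add2l (p.-1 * (m %/ p))) => h.
apply: leq_trans h _; rewrite -mulSnr prednK// mulnC; exact: leq_trunc_div.
Qed.

Section PadicExponential.
Context (R : realType) (p : nat) (K : fieldType) (abs : K -> R).
Context (hp : prime p) (hK : is_padic_complex p abs).
Implicit Types (t u x y z : K) (m n i j M : nat).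

Let habs := padic_abs hK.
Let complete := padic_complete hK.
Let ge0 x : 0 <= abs x := abs_ge0 habs x.
Hint Resolve ge0 : core.

Definition exp_radius : R := p%:R `^ (- (p.-1%:R)^-1).
Local Notation w := exp_radius.

Let p_gt0 : 0 < p%:R :> R.
Proof. by rewrite ltr0n prime_gt0. Qed.

Let p1_gt0 : (0 < p.-1)%N.
Proof. by rewrite -subn1 subn_gt0 prime_gt1. Qed.

Lemma exp_radius_gt0 : 0 < w.
Proof. exact: powR_gt0. Qed.

Lemma exp_radiusX : w ^+ p.-1 = p%:R^-1.
Proof.
rewrite -powR_mulrn ?powR_ge0// -powRrM mulNr mulVf ?powR_inv1 ?ler0n//.
by rewrite pnatr_eq0 -lt0n.
Qed.

Lemma exp_radius_lt1 : w < 1.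
Proof.
rewrite -(expr_lt1 p1_gt0) ?(ltW exp_radius_gt0)// exp_radiusX.
by rewrite invf_lt1// ltr1n prime_gt1.
Qed.

Lemma lt_exp_radius_lt1 t : abs t < w -> abs t < 1.
Proof. by move/lt_trans; apply; apply: exp_radius_lt1. Qed.

Lemma abs_coprime m : coprime p m -> abs m%:R = 1.
Proof.
move=> cpm; apply/eqP; rewrite eq_le abs_nat_le1//= leNgt; apply/negP => m_lt1.
have p_lt1 : abs p%:R < 1.
  by rewrite (padic_abs_p hK) invf_lt1// ltr1n prime_gt1.
have [km kn E _] := egcdnP m (prime_gt0 hp).
have : abs ((km * p)%:R - (kn * m)%:R) < 1.
  by apply: abs_sub_lt => //; rewrite natrM absM//;
    apply: le_lt_trans (ler_piMl _ (abs_nat_le1 habs _)) _.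
rewrite E natrD addrC addKr; move: cpm; rewrite /coprime => /eqP ->.
by rewrite abs1 ?ltxx.
Qed.

Lemma abs_natE m : (0 < m)%N -> abs m%:R = p%:R ^- logn p m.
Proof.
move=> m0; have [m' cpm' E] := pfactor_coprime hp m0.
by rewrite {1}E natrM natrX absM// absX// abs_coprime// mul1r
  (padic_abs_p hK) exprVn.
Qed.

Lemma natrK_neq0 m : (0 < m)%N -> m%:R != 0 :> K.
Proof.
move=> m0; apply/eqP => /(abs_eq0 habs)/eqP.
by rewrite abs_natE// invr_eq0 gt_eqF// exprn_gt0.
Qed.

Lemma abs_fact_ge m : (0 < m)%N -> w ^+ m.-1 <= abs m`!%:R.
Proof.
move=> m0; rewrite abs_natE ?fact_gt0// -exprVn -exp_radiusX -exprM.
apply: ler_wiXn2l; rewrite ?(ltW exp_radius_gt0) ?(ltW exp_radius_lt1)//.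
by have := logn_fact_lt hp m0; case: m {m0}.
Qed.

(** This is where the radius [p ^ (-1 / (p - 1))] comes from: inside it the
    terms of the exponential series decay geometrically and the linear one
    dominates. *)
Lemma abs_exp_term_le t m : abs t < w -> (0 < m)%N ->
  abs (t ^+ m / m`!%:R) <= abs t * (abs t / w) ^+ m.-1.
Proof.
move=> tw m0; rewrite absM// absX// absV//.
case: m m0 => // m _ /=; rewrite exprS -mulrA ler_wpM2l// expr_div_n.
rewrite ler_wpM2l ?exprn_ge0// lef_pV2 ?(abs_fact_ge (ltn0Sn m))//.
  by rewrite posrE abs_gt0// natrK_neq0 ?fact_gt0.
by rewrite posrE exprn_gt0 ?exp_radius_gt0.
Qed.

Lemma radius_ratio_lt1 t : abs t < w -> 0 <= abs t / w < 1.
Proof.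
move=> tw; rewrite divr_ge0 ?(ltW exp_radius_gt0)//=.
by rewrite ltr_pdivrMr ?exp_radius_gt0// mul1r.
Qed.

Lemma abs_exp_term_le_lin t m : abs t < w -> (0 < m)%N ->
  abs (t ^+ m / m`!%:R) <= abs t.
Proof.
move=> tw m0; apply: le_trans (abs_exp_term_le tw m0) _.
have /andP[r0 r1] := radius_ratio_lt1 tw.
by rewrite ler_piMr// exprn_ile1// ltW.
Qed.

Lemma abs_exp_term_le_geo t m : abs t < w ->
  abs (t ^+ m / m`!%:R) <= (abs t / w) ^+ m.
Proof.
move=> tw; have /andP[r0 r1] := radius_ratio_lt1 tw.
case: m => [|m]; first by rewrite !expr0 divr1 abs1.
apply: le_trans (abs_exp_term_le tw (ltn0Sn m)) _.
rewrite exprS ler_wpM2r ?exprn_ge0//=.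
by rewrite ler_pdivlMr ?exp_radius_gt0// ler_piMr// ltW// exp_radius_lt1.
Qed.

Lemma abs_log_term_le t m : (0 < m)%N ->
  abs (t ^+ m / m%:R) <= abs (t ^+ m / m`!%:R).
Proof.
case: m => // m _; rewrite factS natrM invfM mulrA [leRHS]absM// ler_peMr//.
rewrite absV// -[leLHS]invr1 lef_pV2 ?abs_nat_le1 ?posrE ?ltr01//.
by rewrite abs_gt0// natrK_neq0 ?fact_gt0.
Qed.

Lemma cvg_radius_ratio t : abs t < w ->
  (abs t / w) ^+ n @[n --> \oo] --> (0 : R).
Proof.
by move=> /radius_ratio_lt1/andP[r0 r1]; apply: cvg_expr; rewrite ger0_norm.
Qed.

Lemma exp_term_cvg0 t : abs t < w ->
  abs_cvg abs (fun m => t ^+ m / m`!%:R) 0.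
Proof.
move=> tw; apply: (abs_cvg_squeeze habs (cvg_radius_ratio tw)) => m.
by rewrite subr0 abs_exp_term_le_geo.
Qed.

Lemma log_term_cvg0 t : abs t < w ->
  abs_cvg abs (fun m => (-1) ^+ m.+1 * t ^+ m / m%:R) 0.
Proof.
move=> tw; apply: (abs_cvg_squeeze habs (cvg_radius_ratio tw)) => m.
rewrite subr0 -mulrA absM// abs_sign// mul1r.
case: m => [|m].
  by rewrite invr0 mulr0 abs0 // expr0 ler01.
by apply: le_trans (abs_log_term_le _ _) _ => //; apply: abs_exp_term_le_geo.
Qed.

(** * The logarithm as a limit of difference quotients *)

(** Modulo [M] the product [(M - 1) ... (M - j) = 'C(M.-1, j) * j`!] is
    [(-1) ^ j * j`!]. *)
Lemma abs_bin_sign M j : (0 < M)%N ->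
  abs (('C(M.-1, j)%:R - (-1) ^+ j) * j`!%:R) <= abs M%:R.
Proof.
move=> M0; elim: j => [|j IH].
  by rewrite bin0 expr0 subrr mul0r abs0.
have E : 'C(M, j.+1) = ('C(M.-1, j.+1) + 'C(M.-1, j))%N.
  by case: M M0 {IH} => // M _; rewrite binS.
have -> : ('C(M.-1, j.+1)%:R - (-1) ^+ j.+1) * (j.+1)`!%:R =
    M%:R * ('C(M.-1, j) * j`!)%:R
    - j.+1%:R * (('C(M.-1, j)%:R - (-1) ^+ j) * j`!%:R) :> K.
  rewrite -natrM mulnA mul_bin_diag E exprS factS !natrM natrD; ring.
apply: abs_sub_le => //; rewrite absM//.
  by rewrite ler_piMr// abs_nat_le1.
by apply: le_trans IH; rewrite ler_piMl// abs_nat_le1.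
Qed.

(** The binomial formula for [u ^ M] in powers of [u - 1], with
    ['C(M, i) / M] rewritten as ['C(M.-1, i.-1) / i] so that it can be compared
    with the logarithmic series term by term. The term of index 0 vanishes,
    since [0^-1 = 0], and so do those of index above [M]. *)
Lemma difference_quotient_series u M J : (0 < M)%N -> (M < J)%N ->
  (u ^+ M - 1) / M%:R =
  \sum_(0 <= i < J) 'C(M.-1, i.-1)%:R * (u - 1) ^+ i / i%:R.
Proof.
move=> M0 MJ; have -> : u ^+ M = \sum_(0 <= i < J) 'C(M, i)%:R * (u - 1) ^+ i.
  rewrite (big_cat_nat (leq0n _) MJ)/= [X in _ = _ + X]big_nat.
  rewrite [X in _ = _ + X]big1 ?addr0.
    rewrite -{1}(subrK 1 u) exprD1n.
    by rewrite big_mkord; apply: eq_bigr => i _; rewrite mulr_natl.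
  by move=> i /andP[Mi _]; rewrite bin_small// mul0r.
case: J MJ => // J MJ; rewrite !big_nat_recl//= bin0 invr0 mulr0 mulr1 add0r.
rewrite addrC addKr mulr_suml; apply: eq_bigr => i _.
have h : M%:R * 'C(M.-1, i)%:R = i.+1%:R * 'C(M, i.+1)%:R :> K.
  by rewrite -!natrM mul_bin_diag.
apply/eqP; rewrite eqr_div ?natrK_neq0//; apply/eqP.
by rewrite mulrAC [RHS]mulrAC; congr (_ * _); rewrite mulrC -h mulrC.
Qed.

(** The logarithm is the derivative at 0 of [x |-> u ^ x]. The denominators
    [i.+1] of the logarithmic series and [i`!] of [abs_bin_sign] combine into
    [i.+1`!], which the exponential bound absorbs; the estimate is therefore
    uniform in the index of the term. *)
Lemma plog_difference_quotient u M : abs (u - 1) < w -> (0 < M)%N ->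
  abs (plog abs u - (u ^+ M - 1) / M%:R) <= abs M%:R * abs (u - 1).
Proof.
move=> uw M0; apply: abs_sum_sub_le => //; first exact: log_term_cvg0.
exists M.+1 => J MJ; rewrite (difference_quotient_series u M0 MJ) -sumrB.
apply: abs_sum_nat_le; rewrite ?mulr_ge0// => -[_|i _].
  by rewrite invr0 !mulr0 subrr abs0// mulr_ge0.
have -> : (-1) ^+ i.+2 * (u - 1) ^+ i.+1 / i.+1%:R
    - 'C(M.-1, i)%:R * (u - 1) ^+ i.+1 / i.+1%:R =
    - (('C(M.-1, i)%:R - (-1) ^+ i) * i`!%:R)
    * ((u - 1) ^+ i.+1 / i.+1`!%:R).
  rewrite factS natrM !exprS.
  move: (i`!%:R) (natrK_neq0 (fact_gt0 i)) (i.+1%:R) (natrK_neq0 (ltn0Sn i)).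
  by move=> f f0 j j0; field; rewrite f0 j0.
rewrite absM// absN//; apply: ler_pM => //; first exact: abs_bin_sign.
exact: abs_exp_term_le_lin.
Qed.

Lemma abs_pX_cvg0 : abs (p ^ N)%:R @[N --> \oo] --> (0 : R).
Proof.
have -> : (fun N => abs (p ^ N)%:R) = GRing.exp (p%:R^-1 : R).
  by apply: boolp.funext => N; rewrite natrX absX// (padic_abs_p hK).
apply: cvg_expr; rewrite ger0_norm ?invr_ge0 ?(ltW p_gt0)//.
by rewrite invf_lt1// ltr1n prime_gt1.
Qed.

Lemma plog_difference_quotient_le u M : abs (u - 1) < w -> (0 < M)%N ->
  abs (plog abs u - (u ^+ M - 1) / M%:R) <= abs M%:R.
Proof.
move=> uw M0; apply: le_trans (plog_difference_quotient uw M0) _.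
by rewrite ler_piMr// ltW// lt_exp_radius_lt1.
Qed.

Lemma eq0_abs_pX x : (forall N, abs x <= abs (p ^ N)%:R) -> x = 0.
Proof.
move=> h; apply: (@abs_cvg_unique _ _ _ habs (fun=> x)).
  exact: abs_cvg_cst.
by apply: (abs_cvg_squeeze habs abs_pX_cvg0) => N; rewrite subr0.
Qed.

Lemma plog_le u : abs (u - 1) < w -> abs (plog abs u) <= abs (u - 1).
Proof.
move=> uw; rewrite -(subr0 (plog _ _)).
apply: abs_sum_sub_le => //; first exact: log_term_cvg0.
exists 0%N => M _; rewrite subr0; apply: abs_sum_nat_le => // -[_|i _].
  by rewrite invr0 mulr0 abs0.
rewrite -mulrA absM// abs_sign// mul1r.
by apply: le_trans (abs_log_term_le _ _) _ => //; apply: abs_exp_term_le_lin.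
Qed.

(** In the logarithmic series of [u] the linear term [u - 1] strictly
    dominates the others. *)
Lemma plog_eq0 u : abs (u - 1) < w -> plog abs u = 0 -> u = 1.
Proof.
move=> uw lu0; apply/eqP; rewrite -subr_eq0; apply/negPn/negP => t0.
have /andP[r0 r1] := radius_ratio_lt1 uw.
have : abs (plog abs u - (u - 1)) <= abs (u - 1) * (abs (u - 1) / w).
  apply: abs_sum_sub_le => //; first exact: log_term_cvg0.
  exists 2%N => -[//|[//|M]] _; rewrite !big_nat_recl//=.
  rewrite invr0 mulr0 add0r sqrrN !expr1n mul1r divr1 expr1 addrC addKr.
  apply: abs_sum_nat_le => // [|i _]; first exact: mulr_ge0.
  rewrite -mulrA absM// abs_sign// mul1r.
  apply: le_trans (abs_log_term_le _ _) _ => //.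
  apply: le_trans (abs_exp_term_le _ _) _ => //=.
  by rewrite ler_wpM2l// exprS ler_piMr// exprn_ile1// ltW.
rewrite lu0 sub0r absN// leNgt => /negP; apply.
by rewrite gtr_pMr// abs_gt0.
Qed.

(** The difference quotient of [u / v] is, up to a unit, the difference of
    those of [u] and [v]: its limit is 0 when these have the same limit. *)
Lemma plog_inj u v : abs (u - 1) < w -> abs (v - 1) < w ->
  plog abs u = plog abs v -> u = v.
Proof.
move=> uw vw luv; have v1 := abs_eq1 habs (lt_exp_radius_lt1 vw).
have v0 : v != 0.
  apply/eqP => v0; move: v1; rewrite v0 abs0// => /esym/eqP.
  by rewrite oner_eq0.
suff : u / v = 1 by move/(canRL (divfK v0)); rewrite mul1r.
have uvw : abs (u / v - 1) < w.
  rewrite -(divff v0) -mulrBl absM// absV// v1 invr1 mulr1.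
  by rewrite -(subrK 1 u) -addrA -(opprB v) abs_sub_lt.
apply: plog_eq0 => //; apply: eq0_abs_pX => N.
have M0 : (0 < p ^ N)%N by rewrite expn_gt0 prime_gt0.
move: (p ^ N)%N M0 => M M0.
rewrite -[plog abs _](subrK (((u / v) ^+ M - 1) / M%:R)).
apply: abs_add_le => //; first exact: plog_difference_quotient_le.
have -> : ((u / v) ^+ M - 1) / M%:R =
    ((plog abs v - (v ^+ M - 1) / M%:R) - (plog abs u - (u ^+ M - 1) / M%:R))
    / v ^+ M.
  have vM0 : v ^+ M != 0 by rewrite expf_neq0.
  by rewrite luv expr_div_n; have M0' := natrK_neq0 M0; field; rewrite M0' vM0.
rewrite absM// absV// absX// v1 expr1n invr1 mulr1.
by apply: abs_sub_le => //; apply: plog_difference_quotient_le.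
Qed.

(** * The exponential *)

Lemma abs_nat_mul_lt n y : abs y < w -> abs (n%:R * y) < w.
Proof.
by apply: le_lt_trans; rewrite absM// ler_piMl// abs_nat_le1.
Qed.

Lemma pexp_cvg y : abs y < w ->
  abs_cvg abs (fun M => \sum_(0 <= m < M) y ^+ m / m`!%:R) (pexp abs y).
Proof. by move=> yw; apply: abs_cvg_series => //; apply: exp_term_cvg0. Qed.

Lemma pexp0 : pexp abs 0 = 1.
Proof.
apply: (abs_limE habs); apply/(abs_cvgP habs) => e e0.
exists 1%N => -[//|n] _; rewrite big_nat_recl//= expr0 divr1 big1 ?addr0.
  by rewrite subrr abs0.
by move=> i _; rewrite exprS !mul0r.
Qed.

Lemma pexp_sub1_le y : abs y < w -> abs (pexp abs y - 1) <= abs y.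
Proof.
move=> yw; apply: abs_sum_sub_le => //; first exact: exp_term_cvg0.
exists 1%N => -[//|M] _; rewrite big_nat_recl//= expr0 divr1 addrC addKr.
by apply: abs_sum_nat_le => // i _; apply: abs_exp_term_le_lin.
Qed.

Lemma pexp_nat_taylor y M : abs y < w ->
  abs (pexp abs (M%:R * y) - (1 + M%:R * y)) <= abs M%:R ^+ 2 * abs y.
Proof.
move=> yw; apply: abs_sum_sub_le => //.
  by apply: exp_term_cvg0; apply: abs_nat_mul_lt.
exists 2%N => -[//|[//|J]] _; rewrite !big_nat_recl//=.
rewrite expr0 divr1 expr1 divr1 addrA [X in abs X]addrAC subrr add0r.
apply: abs_sum_nat_le; rewrite ?mulr_ge0 ?exprn_ge0// => i _.
rewrite exprMn -mulrA absM//; apply: ler_pM => //.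
  rewrite absX// -[i.+2]addn2 exprD ler_piMl ?exprn_ge0//.
  by rewrite exprn_ile1// abs_nat_le1.
exact: abs_exp_term_le_lin.
Qed.

(** The difference between the product of the partial sums of length [M] and
    the partial sum of the product series only involves terms of total degree
    at least [M]. *)
Lemma pexpD x y : abs x < w -> abs y < w ->
  pexp abs (x + y) = pexp abs x * pexp abs y.
Proof.
move=> xw yw.
have xyw : abs (x + y) < w by rewrite -(opprK y) abs_sub_lt// absN.
pose A z M := \sum_(0 <= m < M) z ^+ m / m`!%:R.
pose r := Num.max (abs x) (abs y) / w.
have rw : Num.max (abs x) (abs y) < w by rewrite gt_max xw.
have m0 : 0 <= Num.max (abs x) (abs y) by rewrite le_max ge0.
have r0 : 0 <= r by rewrite divr_ge0 // ltW// exp_radius_gt0.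
have r1 : r < 1 by rewrite ltr_pdivrMr ?exp_radius_gt0// mul1r.
have term z m : abs z < w -> abs z <= Num.max (abs x) (abs y) ->
    abs (z ^+ m / m`!%:R) <= r ^+ m.
  move=> zw zm; apply: le_trans (abs_exp_term_le_geo _ zw) _.
  have w0 := exp_radius_gt0.
  by rewrite lerXn2r ?nnegrE ?divr_ge0 ?(ltW w0)// ler_pM2r ?invr_gt0.
have Axy M : A (x + y) M = \sum_(0 <= i < M) A x (M - i)%N * (y ^+ i / i`!%:R).
  rewrite -cauchy_product_partial; apply: eq_bigr => m _.
  rewrite exprDn mulr_suml big_mkord; apply: eq_bigr => i _.
  have im : (i <= m)%N by rewrite -ltnS.
  rewrite -(bin_fact im) -[_ *+ _]mulr_natr !natrM.
  have n1 := natrK_neq0 (fact_gt0 i); have n2 := natrK_neq0 (fact_gt0 (m - i)).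
  have n3 : 'C(m, i)%:R != 0 :> K by rewrite natrK_neq0// bin_gt0.
  by field; rewrite n1 n2 n3.
have AB : abs_cvg abs (fun M => A x M * A y M - A (x + y) M) 0.
  apply: (abs_cvg_squeeze habs (e := GRing.exp r)).
    by apply: cvg_expr; rewrite ger0_norm.
  move=> M; rewrite subr0 Axy {2}/A mulr_sumr -sumrB.
  apply: abs_sum_nat_le; rewrite ?exprn_ge0// => i /andP[_ iM].
  rewrite -mulrBl {1}/A (big_cat_nat (leq0n _) (leq_subr i M))/=.
  rewrite addrAC subrr add0r absM// -(subnK (ltnW iM)) [leRHS]exprD.
  apply: ler_pM => //; last by apply: term; rewrite ?le_max ?lexx ?orbT.
  rewrite subnK 1?ltnW//.
  apply: abs_sum_nat_le; rewrite ?exprn_ge0// => m /andP[mM _].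
  apply: le_trans (term _ _ xw _) _; first by rewrite le_max lexx.
  by apply: ler_wiXn2l => //; apply: ltW.
have := abs_cvgD habs AB (pexp_cvg xyw).
rewrite add0r => /(abs_cvg_unique habs); apply.
have := abs_cvgM habs (pexp_cvg xw) (pexp_cvg yw).
by congr abs_cvg; apply: boolp.funext => M; rewrite subrK.
Qed.

Lemma pexp_nat_mul n y : abs y < w -> pexp abs (n%:R * y) = pexp abs y ^+ n.
Proof.
move=> yw; elim: n => [|n IH]; first by rewrite mul0r pexp0.
by rewrite -natr1 mulrDl mul1r pexpD ?abs_nat_mul_lt// IH exprSr.
Qed.

(** Both [log (exp y)] and [y] are within [|M|] of [(exp (M y) - 1) / M] for
    every [M = p ^ N]. *)
Lemma plog_pexp y : abs y < w -> plog abs (pexp abs y) = y.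
Proof.
move=> yw; have e1 := pexp_sub1_le yw; have e1w := le_lt_trans e1 yw.
apply/eqP; rewrite -subr_eq0; apply/eqP; apply: eq0_abs_pX => N.
have M0 : (0 < p ^ N)%N by rewrite expn_gt0 prime_gt0.
move: (p ^ N)%N M0 => M M0; have MK0 := natrK_neq0 M0.
rewrite -[plog abs _](subrK ((pexp abs y ^+ M - 1) / M%:R)) -addrA.
apply: abs_add_le => //.
  exact: plog_difference_quotient_le.
have -> : (pexp abs y ^+ M - 1) / M%:R - y =
    (pexp abs (M%:R * y) - (1 + M%:R * y)) / M%:R.
  by rewrite pexp_nat_mul//; field.
rewrite absM// absV// ler_pdivrMr ?abs_gt0// -expr2.
apply: le_trans (pexp_nat_taylor M yw) _.
by rewrite ler_piMr ?exprn_ge0// ltW// lt_exp_radius_lt1.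
Qed.

(** Both sides lie in the ball on which [log] is injective, and they have the
    same logarithm by [plog_pexp]. *)
Lemma pexp_plog u : abs (u - 1) < w -> pexp abs (plog abs u) = u.
Proof.
move=> uw; have lw := le_lt_trans (plog_le uw) uw.
by apply: plog_inj => //; rewrite ?plog_pexp// (le_lt_trans (pexp_sub1_le lw)).
Qed.

(** * Powers of q and the unit 1 + q *)

Lemma qpow_nat q n : abs (q - 1) < w -> qpow abs q n%:R = q ^+ n.
Proof.
move=> qw; rewrite /qpow pexp_nat_mul ?pexp_plog//.
exact: le_lt_trans (plog_le qw) qw.
Qed.

Lemma qpow_natN q n : abs (q - 1) < w -> qpow abs q (- n%:R) * q ^+ n = 1.
Proof.
move=> qw; have lw := le_lt_trans (plog_le qw) qw.
rewrite -qpow_nat// /qpow mulNr -pexpD ?addNr ?pexp0// ?absN//;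
  exact: abs_nat_mul_lt.
Qed.

(** In particular [q ^ M] tends to 1 along [M = p ^ N]. *)
Lemma abs_expr_sub1_le_nat q M : abs (q - 1) < w -> (0 < M)%N ->
  abs (q ^+ M - 1) <= abs M%:R.
Proof.
move=> qw M0; have q1 : abs (q - 1) <= 1 by rewrite ltW// lt_exp_radius_lt1.
have -> : q ^+ M - 1 = M%:R * ((q ^+ M - 1) / M%:R).
  by rewrite mulrC divfK// natrK_neq0.
rewrite absM// ler_piMr//; apply: le_trans q1.
rewrite -[X in abs X](subKr (plog abs q)).
apply: abs_sub_le => //; first exact: plog_le.
by apply: le_trans (plog_difference_quotient qw M0) _;
  rewrite ler_piMl// abs_nat_le1.
Qed.

(** This uses that [p] is odd: then 2 is a unit and [1 + u] is close to it. *)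
Lemma abs_1D_eq1 u : odd p -> abs (u - 1) < 1 -> abs (1 + u) = 1.
Proof.
move=> podd u1; have two : abs (2%:R : K) = 1.
  by apply: abs_coprime; rewrite coprimen2.
apply/eqP; rewrite eq_le abs_add_le ?abs1 ?(abs_eq1 habs u1)//= leNgt.
apply/negP => h; have := abs_sub_lt habs h u1.
by rewrite (_ : 1 + u - (u - 1) = 2%:R) ?two ?ltxx//; ring.
Qed.

(** * Closed form of the q-Euler polynomials *)

Section ClosedForm.
Context (q : K) (podd : odd p) (qw : abs (q - 1) < w) (q1 : q != 1).

Let q_lt1 : abs (q - 1) < 1 := lt_exp_radius_lt1 qw.

Let qX_lt1 n : abs (q ^+ n - 1) < 1.
Proof. exact: le_lt_trans (abs_expr_sub1 habs n q_lt1) q_lt1. Qed.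

Let abs_1DqX n : abs (1 + q ^+ n) = 1.
Proof. exact: abs_1D_eq1. Qed.

Let qX_neq0 n : 1 + q ^+ n != 0.
Proof.
apply/eqP => h; have := abs_1DqX n; rewrite h abs0// => /esym/eqP.
by rewrite oner_eq0.
Qed.

(** The factor [q ^ (- x)] of the integrand cancels the [q ^ x] of the weight
    [(- q) ^ x], leaving the alternating sum of [[k + x]_q ^ n]. *)
Lemma fermionic_sum_qEuler n k M : odd M ->
  (qnum_neg q M)^-1 * (\sum_(0 <= x < M)
    qpow abs q (- x%:R) * qnum abs q (k%:R + x%:R) ^+ n * (- q) ^+ x) =
  \sum_(0 <= l < n.+1)
    (1 + q) / (1 - q) ^+ n *
      ((-1) ^+ l * 'C(n, l)%:R * q ^+ (k * l) / (1 + q ^+ l)) *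
    ((1 + q ^+ (M * l)) / (1 + q ^+ M)).
Proof.
move=> oM.
have -> : \sum_(0 <= x < M)
    qpow abs q (- x%:R) * qnum abs q (k%:R + x%:R) ^+ n * (- q) ^+ x =
    (1 - q) ^- n * \sum_(0 <= l < n.+1) (-1) ^+ l * 'C(n, l)%:R * q ^+ (k * l)
      * ((1 + q ^+ (M * l)) / (1 + q ^+ l)).
  under eq_bigr => x _.
    rewrite /qnum -natrD qpow_nat// expr_div_n exprNn.
    rewrite (_ : _ * _ = (1 - q) ^- n * ((-1) ^+ x * (1 - q ^+ (k + x)) ^+ n)
      * (qpow abs q (- x%:R) * q ^+ x)); last by ring.
    rewrite qpow_natN// mulr1 (expr_1B (q ^+ _)) mulr_sumr.
    over.
  rewrite -mulr_sumr exchange_big_nat/=; congr (_ * _); apply: eq_bigr => l _.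
  have := sum_alternating_geometric M (qX_neq0 l).
  rewrite -signr_odd oM mulN1r opprK -exprM mulnC => <-; rewrite mulr_sumr.
  by apply: eq_bigr => x _; rewrite -!exprM mulnDl exprD (mulnC l x); ring.
rewrite /qnum_neg exprNn -signr_odd oM mulN1r opprK invf_div mulrA mulr_sumr.
apply: eq_bigr => l _; have a := qX_neq0 l; have b := qX_neq0 M.
have c : 1 - q != 0 by rewrite subr_eq0 eq_sym.
by field; rewrite a b expf_neq0.
Qed.

(** For each [l] the ratio depending on [N] in [fermionic_sum_qEuler] tends
    to 1. *)
Lemma qEuler_polyE n k : qEuler_poly p abs q n k%:R =
  (1 + q) / (1 - q) ^+ n * \sum_(0 <= l < n.+1)
    (-1) ^+ l * 'C(n, l)%:R * q ^+ (k * l) / (1 + q ^+ l).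
Proof.
apply: (abs_limE habs); rewrite mulr_sumr.
have -> : (fun N => (qnum_neg q (p ^ N))^-1 * (\sum_(0 <= x < p ^ N)
    qpow abs q (- x%:R) * qnum abs q (k%:R + x%:R) ^+ n * (- q) ^+ x)) =
    (fun N => \sum_(0 <= l < n.+1)
    (1 + q) / (1 - q) ^+ n *
      ((-1) ^+ l * 'C(n, l)%:R * q ^+ (k * l) / (1 + q ^+ l)) *
    ((1 + q ^+ (p ^ N * l)) / (1 + q ^+ (p ^ N)))).
  apply: boolp.funext => N; apply: fermionic_sum_qEuler.
  by rewrite oddX podd orbT.
apply: abs_cvg_sum => // l; rewrite -[X in abs_cvg _ _ X]mulr1.
apply: abs_cvgZ => //; apply: (abs_cvg_squeeze habs abs_pX_cvg0) => N.
rewrite -[X in _ - X](divff (qX_neq0 (p ^ N))) -mulrBl absM// absV// abs_1DqX.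
rewrite invr1 mulr1 opprD addrACA subrr add0r.
have le1 : abs (q ^+ (p ^ N) - 1) <= abs (p ^ N)%:R.
  by apply: abs_expr_sub1_le_nat; rewrite // expn_gt0 prime_gt0.
rewrite -(subrK 1 (q ^+ (_ * _))) -addrA -(opprB (q ^+ (p ^ N))).
apply: abs_sub_le => //; apply: le_trans le1.
by rewrite exprM; apply: abs_expr_sub1.
Qed.

Lemma qEuler_poly0 n : qEuler p abs q n = qEuler_poly p abs q n 0.
Proof.
by congr fermionic_int; apply: boolp.funext => x; rewrite add0r.
Qed.

(** Both parities of [k] at once. With the closed forms, the difference is a
    linear combination of the quotients
    [(1 - (-1) ^ k q ^ (k l)) / (1 + q ^ l)], which are alternating geometric
    sums. *)
Lemma qEuler_sub_signed_poly n k :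
  qEuler p abs q n - (-1) ^+ k * qEuler_poly p abs q n k%:R =
  qnum abs q 2%:R *
    \sum_(0 <= l < k) (-1) ^+ l * qnum abs q l%:R ^+ n.
Proof.
have c : 1 - q != 0 by rewrite subr_eq0 eq_sym.
have -> : qnum abs q 2%:R = 1 + q.
  by rewrite /qnum qpow_nat//; field.
under [in RHS]eq_bigr => j _.
  rewrite /qnum qpow_nat// expr_div_n (expr_1B (q ^+ _)) mulrA.
  rewrite [_ * (1 - q) ^- n]mulrC [(-1) ^+ j * _]mulr_sumr.
  over.
rewrite -mulr_sumr exchange_big_nat/= mulrA.
rewrite qEuler_poly0 -(mulr0n 1) !qEuler_polyE mulrCA -mulrBr; congr (_ * _).
rewrite mulr_sumr -sumrB; apply: eq_bigr => l _.
rewrite mul0n expr0 mulr1 -mulrA.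
transitivity ((-1) ^+ l * 'C(n, l)%:R *
    ((1 - (-1) ^+ k * (q ^+ l) ^+ k) / (1 + q ^+ l))).
  by rewrite -exprM mulnC; have a := qX_neq0 l; field.
rewrite -sum_alternating_geometric// mulr_sumr; apply: eq_bigr => j _.
by rewrite -!exprM mulnC; ring.
Qed.

End ClosedForm.
End PadicExponential.

Theorem theorem7 (R : realType) (p : nat) (K : fieldType) (abs : K -> R)
    (q : K) (n k : nat) (hp : prime p) (hodd : odd p)
    (hK : is_padic_complex p abs)
    (hq : abs (q - 1) < p%:R `^ (- (p.-1%:R)^-1)) (hq1 : q != 1)
    (hk : (0 < k)%N) :
  (~~ odd k ->
     qEuler p abs q n - qEuler_poly p abs q n k%:R
     = qnum abs q 2%:R *
       \sum_(0 <= l < k) (-1) ^+ l * qnum abs q l%:R ^+ n) /\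
  (odd k ->
     qEuler p abs q n + qEuler_poly p abs q n k%:R
     = qnum abs q 2%:R *
       \sum_(0 <= l < k) (-1) ^+ l * qnum abs q l%:R ^+ n).
Proof.
rewrite -(qEuler_sub_signed_poly hp hK hodd hq hq1 n k) -signr_odd.
by split=> [/negbTE|] ->; rewrite ?expr0 ?mul1r// mulN1r opprK.
Qed.
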